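(* Let $(G,\lambda)$ be an always star temporal graph with lifetime $T$ and $m$ underlying edges, and let $\Delta$ be an integer with $T\ge \Delta$ and $\Delta\ge 2$. The algorithm STAR-ACOV (described in the context) approximates the Sliding Window Temporal Vertex Cover problem with window size $\Delta$ on $(G,\lambda)$ with approximation ratio $\Delta-1$, i.e. the size of the returned temporal vertex set is at most $(\Delta-1)$ times the size of a minimum sliding $\Delta$-window temporal vertex cover, and it runs in $\mathcal{O}(Tm\Delta^2)$ time.
   Context: A temporal graph is a pair $(G,\lambda)$ where $G=(V,E)$ is a finite undirected graph (the underlying graph) with $n=|V|$, $m=|E|$, and $\lambda:E\to 2^{\mathbb{N}}$ assigns to each edge a set of discrete time labels, all lying in $\{1,\dots,T\}$, where $T$ is the lifetime. An edge $e$ is active at time $t$ if $t\in\lambda(e)$. The snapshot $G_t$ is the subgraph of active edges at time $t$. The temporal graph is an always star temporal graph if every snapshot $G_t$ is a star (the center may differ between time steps); let $c_t$ denote the star center of $G_t$. A vertex appearance is a pair $(u,t)$ with $u\in V$, $1\le t\le T$; it temporally covers an edge $e$ if $u$ is an endpoint of $e$ and $t\in\lambda(e)$. For a window size $\Delta$, the time window $W_t=\{t,\dots,t+\Delta-1\}$ for $t\in\{1,\dots,T-\Delta+1\}$, and $E[W_t]=\{e\in E:\lambda(e)\cap W_t\ne\emptyset\}$. Sliding Window Temporal Vertex Cover ($\Delta$-TVC): find a set $S$ of vertex appearances of minimum cardinality such that for every window $W_t$ and every $e\in E[W_t]$, $e$ is temporally covered by some $(w,t')\in S$ with $t'\in W_t$.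 Algorithm STAR-ACOV: it maintains, for the current window, a $\Delta\times m$ table recording for each time step of the window which edges are active (updated as a ring buffer when the window slides by one step), and a status for each time step of the window: the star center is included in the cover, available, or excluded. Starting with an empty output $\mathcal{X}$, for each window $W_t$, $t=1,\dots,T-\Delta+1$ (after updating the table and statuses for the new time step $t+\Delta-1$), it iterates over the time steps $t+i$, $i=0,\dots,\Delta-1$: if the center at $t+i$ is already included, it continues; else if some edge active at $t+i$ is not covered by the star center of another non-excluded time step of $W_t$, it adds $(c_{t+i},t+i)$ to $\mathcal{X}$ and marks it included; otherwise it marks $t+i$ excluded and, for each edge active at $t+i$, adds to $\mathcal{X}$ (and marks included) the star center of an optimally chosen other time step $t+j$ of $W_t$ that covers that edge, namely one already included if possible, otherwise the latest possible one. It returns $\mathcal{X}$. An approximation ratio $\rho$ means that on every input the output size is at most $\rho$ times the optimum size.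
   Formalization: When the window slides, excluded time steps become available again; if exclusions persist across windows the ratio fails (Δ=3, T=7, one centre, snapshots b, abcd, abc, b, abc, ac, a: output 5, optimum 2). The time bound is stated for m≥1. *)

(* Defs.v *)
(* MathComp, with finmap for finite sets of vertex appearances. *)
From mathcomp Require Export all_boot finmap.
Set Implicit Arguments.
Unset Strict Implicit.
Unset Printing Implicit Defensive.

(* An edge is a two-element set of vertices; [labels] is only meaningful on
   [edges]. *)
Record tgraph (V : finType) := TGraph {
  edges : {set {set V}};
  labels : {set V} -> {fset nat};
  lifetime : nat;
  edges_card2 : forall e, e \in edges -> #|e| = 2;
  labels_lifetime : forall e t,
    e \in edges -> t \in labels e -> 1 <= t <= lifetime
}.

Section SlidingWindowCover.
Variables (V : finType) (G : tgraph V).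

Definition snapshot (t : nat) : {set {set V}} :=
  [set e in edges G | t \in labels G e].

Definition star_with_center (F : {set {set V}}) (u : V) : Prop :=
  forall e, e \in F -> u \in e.

(* [c t] is the center of the star [snapshot t].  It is not unique when the
   snapshot has at most one edge; an edgeless snapshot is a degenerate star. *)
Definition always_star (c : nat -> V) : Prop :=
  forall t, 1 <= t <= lifetime G -> star_with_center (snapshot t) (c t).

Definition in_window (D t s : nat) : bool := t <= s < t + D.

Definition window_edges (D t : nat) : {set {set V}} :=
  [set e in edges G | has (fun s => in_window D t s) (labels G e)].

Definition temporally_covers (a : V * nat) (e : {set V}) : bool :=
  (a.1 \in e) && (a.2 \in labels G e).

Definition is_tvc (D : nat) (S : {fset V * nat}) : Prop :=
  (forall a, a \in S -> 1 <= a.2 <= lifetime G) /\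
  (forall t, 1 <= t <= lifetime G - D + 1 ->
   forall e, e \in window_edges D t ->
   exists a, [/\ a \in S, in_window D t a.2 & temporally_covers a e]).

Definition is_minimum_tvc (D : nat) (S : {fset V * nat}) : Prop :=
  is_tvc D S /\ forall S', is_tvc D S' -> #|` S| <= #|` S'|.

End SlidingWindowCover.

Inductive status := Included | Available | Excluded.

Definition included (s : status) : bool :=
  if s is Included then true else false.
Definition excluded (s : status) : bool :=
  if s is Excluded then true else false.

(* The memory of the algorithm: the table (ring-buffer row, edge), the status
   of each row, and the output.  Only rows below the window size are used, and
   each is written before it is read. *)
Record memory (V : finType) := Memory {
  table : nat -> {set V} -> bool;
  stat : nat -> status;
  cover : {fset V * nat}
}.

Definition memory0 (V : finType) : memory V :=
  Memory (fun _ _ => false) (fun _ => Available) fset0.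

(* Unit-cost computations: a program maps a memory to its running time, the
   final memory and a result.  Every access to the input, the table, the
   statuses or the output is a [prim], costing 1, and every loop charges 1 per
   iteration and 1 for its exit.  What is left uncharged is a bounded amount of
   arithmetic and branching on local values between two charged steps. *)
Definition prog (V : finType) (A : Type) := memory V -> nat * memory V * A.

Section Programs.
Variable V : finType.

Definition ret (A : Type) (a : A) : prog V A := fun s => (0, s, a).

Definition bind (A B : Type) (p : prog V A) (q : A -> prog V B) : prog V B :=
  fun s => let: (k1, s1, a) := p s in
           let: (k2, s2, b) := q a s1 in (k1 + k2, s2, b).

Definition prim (A : Type) (f : memory V -> memory V * A) : prog V A :=
  fun s => let: (s1, a) := f s in (1, s1, a).

Fixpoint fold_loop (I A : Type) (l : seq I) (a : A) (body : A -> I -> prog V A)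
    : prog V A :=
  if l is i :: l' then
    bind (prim (fun s => (s, tt))) (fun _ =>
    bind (body a i) (fun a' => fold_loop l' a' body))
  else prim (fun s => (s, a)).

Definition loop (I : Type) (l : seq I) (body : I -> prog V unit) : prog V unit :=
  fold_loop l tt (fun _ i => body i).

Definition read_cell (r : nat) (e : {set V}) : prog V bool :=
  prim (fun s => (s, table s r e)).

Definition write_cell (r : nat) (e : {set V}) (b : bool) : prog V unit :=
  prim (fun s =>
    (Memory (fun r' e' => if (r' == r) && (e' == e) then b else table s r' e')
            (stat s) (cover s), tt)).

Definition read_status (r : nat) : prog V status :=
  prim (fun s => (s, stat s r)).

Definition write_status (r : nat) (x : status) : prog V unit :=
  prim (fun s =>
    (Memory (table s) (fun r' => if r' == r then x else stat s r') (cover s),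
     tt)).

Definition add_output (a : V * nat) : prog V unit :=
  prim (fun s => (Memory (table s) (stat s) (a |` cover s)%fset, tt)).

End Programs.

Notation "'exec' x <- p ; q" := (bind p (fun x => q))
  (at level 200, x name, p at level 100, q at level 200).

Section StarAcov.
Variables (V : finType) (G : tgraph V) (c : nat -> V) (D : nat).

Definition query_label (e : {set V}) (t : nat) : prog V bool :=
  prim (fun s => (s, t \in labels G e)).

Definition query_center (t : nat) : prog V V := prim (fun s => (s, c t)).

(* The ring-buffer row of time step t. *)
Definition row (t : nat) : nat := t %% D.

Definition load_step (t : nat) : prog V unit :=
  exec _ <- loop (enum (edges G)) (fun e =>
       exec b <- query_label e t; write_cell (row t) e b);
  write_status (row t) Available.

(* Exclusion is relative to the current window: when the window slides, the
   included steps stay included and all the others are available again.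
   (With exclusions kept across windows the ratio fails: for D = 3 there is a
   single-center instance with T = 7 and output of size 5 against optimum 2.) *)
Definition slide_window (t : nat) : prog V unit :=
  exec _ <- load_step (t + D - 1);
  loop (iota 0 D) (fun i =>
    exec x <- read_status (row (t + i));
    if excluded x then write_status (row (t + i)) Available else ret tt).

(* A step is output at most once, so that the output can be stored as a list
   extended in constant time. *)
Definition include_step (t : nat) : prog V unit :=
  exec x <- read_status (row t);
  if included x then ret tt else
  exec u <- query_center t;
  exec _ <- add_output (u, t);
  write_status (row t) Included.

Definition covered_by_other (t i : nat) (e : {set V}) : prog V bool :=
  fold_loop (iota 0 D) false (fun found j =>
    exec b <- read_cell (row (t + j)) e;
    exec x <- read_status (row (t + j));
    ret (found || [&& j != i, b & ~~ excluded x])).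

Definition has_uncovered_edge (t i : nat) : prog V bool :=
  fold_loop (enum (edges G)) false (fun found e =>
    exec b <- read_cell (row (t + i)) e;
    if b then
      exec cov <- covered_by_other t i e;
      ret (found || ~~ cov)
    else ret found).

(* The accumulator holds the latest included and the latest available step
   other than t + i covering e that were found so far. *)
Definition best_other (t i : nat) (e : {set V}) : prog V (option nat) :=
  exec best <- fold_loop (iota 0 D) (None, None) (fun acc j =>
    exec b <- read_cell (row (t + j)) e;
    exec x <- read_status (row (t + j));
    ret (if (j != i) && b then
             match x with
             | Included => (Some (t + j), acc.2)
             | Available => (acc.1, Some (t + j))
             | Excluded => acc
             end
           else acc));
  ret (if best.1 is Some s then Some s else best.2).

Definition process_step (t i : nat) : prog V unit :=
  exec x <- read_status (row (t + i));
  if included x then ret tt else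
  exec needed <- has_uncovered_edge t i;
  if needed then include_step (t + i) else
  exec _ <- write_status (row (t + i)) Excluded;
  loop (enum (edges G)) (fun e =>
    exec b <- read_cell (row (t + i)) e;
    if b then
      exec o <- best_other t i e;
      if o is Some s then include_step s else ret tt
    else ret tt).

Definition star_acov : prog V unit :=
  exec _ <- loop (iota 1 (D - 1)) load_step;
  loop (iota 1 (lifetime G - D + 1)) (fun t =>
    exec _ <- slide_window t;
    loop (iota 0 D) (process_step t)).

Definition star_acov_output : {fset V * nat} :=
  cover (star_acov (memory0 V)).1.2.

Definition star_acov_time : nat := (star_acov (memory0 V)).1.1.

End StarAcov.

(* Main.v *)
(* Edge by edge the algorithm is greedy: whenever a window [t, t + D) has an
   edge e and no included step covers e, it includes the latest step of the
   window covering e. This is clear when a step is added to replace an excluded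
   one, since the available steps come after the processed ones. When a step is
   added because it has an uncovered edge e, every excluded step has its edges
   covered by included ones, hence no other step of the window covers e.
   So if y was added for e in the window starting at t, any cover S has a step
   a in that window covering e, and t <= a <= y < t + D; charge y to a. The
   steps charged to a lie in [a, a + D), which gives the ratio D; and a and
   a + D - 1 are not both charged to a. Indeed a + D - 1 can only be charged in
   the window starting at a, at a time when a, being the first step of that
   window, has been excluded and will never be included. *)
Require Import Defs.
From mathcomp Require Import zify.
Set Implicit Arguments.
Unset Strict Implicit.
Unset Printing Implicit Defensive.

(** * Rules for the effect, the result and the cost of programs *)

Section ProgramLogic.
Variable V : finType.
Implicit Types s : memory V.

Definition final A (p : prog V A) s : memory V := (p s).1.2.
Definition result A (p : prog V A) s : A := (p s).2.

Lemma final_bind A B (p : prog V A) (q : A -> prog V B) s :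
  final (bind p q) s = final (q (result p s)) (final p s).
Proof.
by rewrite /final /result /bind; case: (p s) => [[k1 s1] a] /=; case: (q a s1) => [[]].
Qed.

Lemma result_bind A B (p : prog V A) (q : A -> prog V B) s :
  result (bind p q) s = result (q (result p s)) (final p s).
Proof.
by rewrite /final /result /bind; case: (p s) => [[k1 s1] a] /=; case: (q a s1) => [[]].
Qed.

Definition pure_prog A (p : prog V A) (f : memory V -> A) :=
  forall s, final p s = s /\ result p s = f s.

Lemma final_read_cell r (e : {set V}) s : final (read_cell r e) s = s.
Proof. by []. Qed.

Lemma result_read_cell r (e : {set V}) s : result (read_cell r e) s = table s r e.
Proof. by []. Qed.

Lemma final_read_status r s : final (read_status r) s = s.
Proof. by []. Qed.

Lemma result_read_status r s : result (read_status r) s = stat s r.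
Proof. by []. Qed.

Lemma pure_fold I A (l : seq I) (a : A) body (f : memory V -> A -> I -> A) :
    (forall b i, pure_prog (body b i) (fun s => f s b i)) ->
  pure_prog (fold_loop l a body) (fun s => foldl (f s) a l).
Proof.
move=> hb; elim: l a => [|i l IH] a s //=.
rewrite !final_bind !result_bind /=.
by have [-> ->] := hb a i (final (prim (fun s => (s, tt))) s); apply: IH.
Qed.

(** The invariant is indexed by the prefix already traversed; the equation [l = l1 ++ i :: l2] keeps
    the information that [i] occurs in [l]. *)
Lemma fold_loop_inv I A (l : seq I) (a : A) (body : A -> I -> prog V A)
    (J : seq I -> A -> memory V -> Prop) s :
    (forall l1 i l2 b s', l = l1 ++ i :: l2 -> J l1 b s' ->
       J (rcons l1 i) (result (body b i) s') (final (body b i) s')) ->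
  J [::] a s -> J l (result (fold_loop l a body) s) (final (fold_loop l a body) s).
Proof.
move=> hJ; suff: forall l1 l2 a s, l = l1 ++ l2 -> J l1 a s ->
  J l (result (fold_loop l2 a body) s) (final (fold_loop l2 a body) s) by apply.
move=> l1 l2; elim: l2 l1 => [|i l2 IH] l1 b s' El H /=.
  by rewrite cats0 in El; rewrite El.
rewrite !final_bind !result_bind /=.
by apply: (IH (rcons l1 i)); [rewrite cat_rcons | apply: hJ El _].
Qed.

Lemma loop_inv I (l : seq I) (body : I -> prog V unit)
    (J : seq I -> memory V -> Prop) s :
    (forall l1 i l2 s', l = l1 ++ i :: l2 -> J l1 s' ->
       J (rcons l1 i) (final (body i) s')) ->
  J [::] s -> J l (final (loop l body) s).
Proof.
move=> hJ; apply: (@fold_loop_inv _ _ l tt (fun _ => body) (fun l1 _ => J l1)).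
by move=> l1 i l2 _; apply: hJ.
Qed.

Lemma loop_iota_inv m n (body : nat -> prog V unit)
    (J : nat -> memory V -> Prop) s :
    (forall i s', m <= i < m + n -> J i s' -> J i.+1 (final (body i) s')) ->
  J m s -> J (m + n) (final (loop (iota m n) body) s).
Proof.
move=> hJ Jm; rewrite -{1}[n](size_iota m).
apply: (@loop_inv _ _ _ (fun l1 => J (m + size l1))); last by rewrite addn0.
move=> l1 i l2 s' El H; have El1 : i = m + size l1.
  have := congr1 (nth 0 ^~ (size l1)) El; rewrite nth_cat ltnn subnn /= => <-.
  rewrite nth_iota //; have := congr1 size El.
  by rewrite size_cat size_iota /=; lia.
rewrite size_rcons addnS -El1; apply: hJ; last by rewrite El1.
have := congr1 size El; rewrite size_cat size_iota /=; lia.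
Qed.

Definition costs A (p : prog V A) (k : nat) := forall s, (p s).1.1 <= k.

Lemma costsW A (p : prog V A) k k' : costs p k -> k <= k' -> costs p k'.
Proof. by move=> h hk s; apply: leq_trans hk. Qed.

Lemma costs_ret A (a : A) : costs (ret a) 0.
Proof. by []. Qed.

Lemma costs_prim A (f : memory V -> memory V * A) : costs (prim f) 1.
Proof. by move=> s; rewrite /prim; case: (f s). Qed.

Lemma costs_bind A B (p : prog V A) (q : A -> prog V B) k k' :
  costs p k -> (forall a, costs (q a) k') -> costs (bind p q) (k + k').
Proof.
move=> hp hq s; rewrite /bind; have := hp s.
case: (p s) => [[k1 s1] a] /= h1; have := hq a s1.
by case: (q a s1) => [[k2 s2] b] /= h2; apply: leq_add.
Qed.

Lemma costs_fold I A (l : seq I) (a : A) (body : A -> I -> prog V A) k :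
  (forall b i, costs (body b i) k) -> costs (fold_loop l a body) (size l * k.+1).+1.
Proof.
move=> hb; elim: l a => [|i l IH] a; first exact: costs_prim.
apply: (costsW (k := 1 + (k + (size l * k.+1).+1))) => [|/=]; last by lia.
apply: costs_bind => [|_]; first exact: costs_prim.
by apply: costs_bind.
Qed.

Lemma costs_loop I (l : seq I) (body : I -> prog V unit) k :
  (forall i, costs (body i) k) -> costs (loop l body) (size l * k.+1).+1.
Proof. by move=> hb; apply: costs_fold. Qed.

End ProgramLogic.

Lemma foldl_has (I : Type) (P : pred I) (b : bool) (l : seq I) :
  foldl (fun found i => found || P i) b l = b || has P l.
Proof. by elim: l b => [|i l IH] b /=; rewrite ?orbF // IH orbA. Qed.

Section StarAcovAnalysis.
Variables (V : finType) (G : tgraph V) (c : nat -> V) (D : nat).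
Implicit Types (s : memory V) (X : {fset V * nat}) (e : {set V}).

Local Notation lambda := (labels G).
Local Notation row := (row D).

(** * Running time *)

Section Time.
Hypotheses (D_gt0 : 0 < D) (m_gt0 : 0 < #|edges G|).
Local Notation m := (#|edges G|).

Lemma costs_load_step t : costs (load_step G D t) (5 * m).
Proof.
apply: (@costsW _ _ _ ((size (enum (edges G)) * 3).+1 + 1)); last first.
  by rewrite -cardE; lia.
apply: costs_bind => [|_]; last exact: costs_prim.
apply: costs_loop => e.
by apply: (@costs_bind _ _ _ _ _ 1 1) => [|b]; exact: costs_prim.
Qed.

Lemma costs_slide_window t : costs (slide_window G D t) (9 * (m * D)).
Proof.
apply: (@costsW _ _ _ (5 * m + (size (iota 0 D) * 3).+1)); last first.
  by rewrite size_iota; nia.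
apply: costs_bind => [|_]; first exact: costs_load_step.
apply: costs_loop => i.
apply: (@costs_bind _ _ _ _ _ 1 1) => [|x]; first exact: costs_prim.
by case: (excluded x); [exact: costs_prim | exact: (costsW (@costs_ret _ _ _))].
Qed.

Lemma costs_include_step t : costs (include_step c D t) 4.
Proof.
apply: (@costs_bind _ _ _ _ _ 1 3) => [|x]; first exact: costs_prim.
case: (included x); first exact: (costsW (@costs_ret _ _ _)).
apply: (@costs_bind _ _ _ _ _ 1 2) => [|u]; first exact: costs_prim.
by apply: (@costs_bind _ _ _ _ _ 1 1) => [|_]; exact: costs_prim.
Qed.

Lemma costs_covered_by_other t i e : costs (covered_by_other D t i e) (4 * D).
Proof.
apply: (@costsW _ _ _ (size (iota 0 D) * 3).+1); last by rewrite size_iota; lia.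
apply: costs_fold => b j.
apply: (@costs_bind _ _ _ _ _ 1 1) => [|b']; first exact: costs_prim.
by apply: (@costs_bind _ _ _ _ _ 1 0) => [|x]; [exact: costs_prim | exact: costs_ret].
Qed.

Lemma costs_best_other t i e : costs (best_other D t i e) (4 * D).
Proof.
apply: (@costsW _ _ _ ((size (iota 0 D) * 3).+1 + 0)); last by rewrite size_iota; lia.
apply: costs_bind => [|best]; last exact: costs_ret.
apply: costs_fold => b j.
apply: (@costs_bind _ _ _ _ _ 1 1) => [|b']; first exact: costs_prim.
by apply: (@costs_bind _ _ _ _ _ 1 0) => [|x]; [exact: costs_prim | exact: costs_ret].
Qed.

Lemma costs_has_uncovered_edge t i :
  costs (has_uncovered_edge G D t i) (7 * (m * D)).
Proof.
apply: (@costsW _ _ _ (size (enum (edges G)) * (1 + 4 * D).+1).+1); last first.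
  by rewrite -cardE; nia.
apply: costs_fold => found e.
apply: costs_bind => [|b]; first exact: costs_prim.
case: b; last exact: (costsW (@costs_ret _ _ _)).
rewrite -[4 * D]addn0; apply: costs_bind => [|b]; first exact: costs_covered_by_other.
exact: costs_ret.
Qed.

Lemma costs_process_step t i : costs (process_step G c D t i) (25 * (m * D)).
Proof.
apply: (@costsW _ _ _ (1 + (7 * (m * D) + 12 * (m * D)))); last by nia.
apply: costs_bind => [|x]; first exact: costs_prim.
case: (included x); first exact: (costsW (@costs_ret _ _ _)).
apply: costs_bind => [|needed]; first exact: costs_has_uncovered_edge.
case: needed; first by apply: (costsW (costs_include_step _)); nia.
apply: (@costsW _ _ _ (1 + (size (enum (edges G)) * (1 + (4 * D + 4)).+1).+1)); last first.
  by rewrite -cardE; nia.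
apply: costs_bind => [|_]; first exact: costs_prim.
apply: costs_loop => e.
apply: costs_bind => [|b]; first exact: costs_prim.
case: b; last exact: (costsW (@costs_ret _ _ _)).
apply: costs_bind => [|[y|]]; first exact: costs_best_other.
  exact: costs_include_step.
exact: (costsW (@costs_ret _ _ _)).
Qed.

(** Each of at most [T] windows processes [D] steps at cost O(mD) each. As [m] and [D] are positive,
    loop overheads are absorbed: preloading and main loop cost at most [6Tm + 1] and [38TmD^2 + 1],
    which leaves some slack below 50. *)
Lemma star_acov_timeP :
  D <= lifetime G -> star_acov_time G c D <= 50 * (lifetime G * m * D ^ 2).
Proof.
move=> leDT; pose T := lifetime G.
have H : costs (star_acov G c D)
    ((size (iota 1 (D - 1)) * (5 * m).+1).+1
     + (size (iota 1 (T - D + 1)) * (9 * (m * D) + (D * (25 * (m * D)).+1).+1).+1).+1).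
  apply: costs_bind => [|_]; first by apply: costs_loop => t; exact: costs_load_step.
  apply: costs_loop => t; apply: costs_bind => [|_]; first exact: costs_slide_window.
  apply: (@costsW _ _ _ (size (iota 0 D) * (25 * (m * D)).+1).+1); last by rewrite size_iota.
  by apply: costs_loop => i; exact: costs_process_step.
apply: leq_trans (H _) _; rewrite !size_iota -/T.
have le1 : (D - 1) * (5 * m).+1 <= T * (6 * m) by apply: leq_mul; rewrite /T; lia.
have h1 : 1 <= m * D by rewrite muln_gt0 m_gt0.
have h2 : m * D <= m * D ^ 2 by rewrite leq_mul2l -{1}[D]expn1 leq_pexp2l ?orbT.
have h3 : m <= m * D by rewrite leq_pmulr.
have le2 : (T - D + 1) * (9 * (m * D) + (D * (25 * (m * D)).+1).+1).+1
    <= T * (38 * (m * D ^ 2)).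
  apply: leq_mul; first by rewrite /T; lia.
  have -> : D * (25 * (m * D)).+1 = 25 * (m * D ^ 2) + D by rewrite mulnS mulnCA; nia.
  nia.
have h4 : m <= m * D ^ 2 by apply: leq_trans h2.
have h5 : T * m <= T * (m * D ^ 2) by rewrite leq_mul2l h4 orbT.
have h6 : 1 <= T * (m * D ^ 2) by rewrite muln_gt0; apply/andP; split; [rewrite /T | ]; lia.
rewrite -mulnA; lia.
Qed.

End Time.

(** * The ring buffer and the invariants of the current window *)

Lemma row_inj t y z :
  in_window D t y -> in_window D t z -> row y = row z -> y = z.
Proof.
rewrite /in_window /row => hy hz; wlog le_yz : y z hy hz / y <= z.
  by move=> h; case/orP: (leq_total y z) => le h'; [|symmetry]; apply: h.
(* [D] divides [z - y], which is less than [D] inside a window, hence zero. *)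
move/eqP; rewrite eq_sym eqn_mod_dvd // => /dvdn_leq; lia.
Qed.

(* [witnessed X t y]: in window [t], the step [y] is the latest one covering
   some edge [e], and was added at a time when no step covering [e] was
   included. Of the latter only the consequence for the first step of the
   window is recorded, in a form that stays true of the final output. *)
Definition witnessed X t y := exists e,
  [/\ e \in edges G, in_window D t y, y \in lambda e,
      forall z, in_window D t z -> z \in lambda e -> z <= y
    & t \in lambda e -> t != y -> (c t, t) \notin X].

(** That [c z] is an endpoint of [e] comes from the star hypothesis, at the moment when [hit] is
    turned into temporal coverage. *)
Definition hit X t e :=
  exists z, [/\ in_window D t z, z \in lambda e & (c z, z) \in X].

Definition include_mem y s : memory V :=
  Memory (table s) (fun r => if r == row y then Included else stat s r)
         ((c y, y) |` cover s)%fset.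

(** Rows are loaded for the steps of [[lo, hi)], the witness windows of the output start before [b],
    and the windows starting before [lo] are finished. *)
Record core lo hi b s : Prop := Core {
  core_table : forall y e, lo <= y < hi -> e \in edges G ->
    table s (row y) e = (y \in lambda e);
  core_stat : forall y, lo <= y < hi ->
    included (stat s (row y)) = ((c y, y) \in cover s);
  core_cover : forall a, a \in cover s -> a.1 = c a.2 /\ 1 <= a.2 < hi;
  core_witness : forall a, a \in cover s ->
    exists2 t, 1 <= t < b & witnessed (cover s) t a.2;
  core_past : forall t e, 1 <= t < lo -> e \in window_edges G D t ->
    hit (cover s) t e }.

(** Steps before [m] have their edges served; steps before [n] are no longer available. The bounds
    differ only while the edges of a freshly excluded step are being served: then [n = m + 1]. *)
Record window_inv t b m n s : Prop := WindowInv {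
  wi_core : core t (t + D) b s;
  wi_excl : forall y, in_window D t y -> stat s (row y) = Excluded -> y < n;
  wi_avail : forall y, in_window D t y -> stat s (row y) = Available -> n <= y;
  wi_done : forall y e, t <= y < m -> e \in edges G -> y \in lambda e ->
    hit (cover s) t e }.

Lemma witnessed_include X t y z :
  (t != z -> t != y) -> witnessed X t z -> witnessed ((c y, y) |` X)%fset t z.
Proof.
move=> hy [e [eG tz ze lst tX]]; exists e; split=> // te tNz.
rewrite in_fset1U negb_or tX // andbT; apply: contra (hy tNz).
by case/eqP=> _ ->.
Qed.

Lemma hit_include X a t e : hit X t e -> hit (a |` X)%fset t e.
Proof. by case=> z [tz ze zX]; exists z; split=> //; rewrite in_fset1U zX orbT. Qed.

Lemma core_widen lo hi b b' s : b <= b' -> core lo hi b s -> core lo hi b' s.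
Proof.
move=> le_b [h1 h2 h3 h4 h5]; split=> // a /h4 [t tb w]; exists t => //; lia.
Qed.

Lemma core_restat lo hi b s s' :
    table s' = table s -> cover s' = cover s ->
    (forall y, lo <= y < hi ->
       included (stat s' (row y)) = included (stat s (row y))) ->
  core lo hi b s -> core lo hi b s'.
Proof.
move=> et ec es [h1 h2 h3 h4 h5]; split; rewrite ?et ?ec //.
by move=> y hy; rewrite es // h2.
Qed.

(** The delicate clause of an old witness is the one keeping the first step of its window out of the
    output. Old witness windows start before [b <= y], so adding [y] does not break it; [y] itself
    gets the current window as witness. *)
Lemma core_include t b y s :
    1 <= t -> b <= t.+1 -> b <= y -> witnessed (cover s) t y ->
  core t (t + D) b s -> core t (t + D) t.+1 (include_mem y s).
Proof.
move=> t0 bt by_ w [h1 h2 h3 h4 h5].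
have ty : in_window D t y by case: w => e [].
split=> //=.
- move=> z tz; rewrite in_fset1U; case: eqP => [|ne].
    by move/(row_inj tz ty) ->; rewrite eqxx.
  rewrite h2 //; case: eqP => // -[_ Ez]; by rewrite Ez in ne.
- move=> a /fset1UP[-> /=|/h3 //]; split=> //; move: ty; rewrite /in_window; lia.
- move=> a /fset1UP[-> /=|/h4 [t' t'b w']].
    by exists t; [lia | apply: witnessed_include].
  exists t'; first by lia.
  by apply: witnessed_include w' => _; apply/eqP; lia.
- by move=> t' e ht' he; apply: hit_include; apply: h5.
Qed.

Lemma window_inv_include t b m n y s :
    1 <= t -> b <= t.+1 -> b <= y -> witnessed (cover s) t y ->
  window_inv t b m n s -> window_inv t t.+1 m n (include_mem y s).
Proof.
move=> t0 bt by_ w [h1 h2 h3 h4]; split=> /=.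
- exact: core_include by_ w h1.
- by move=> z tz; case: eqP => // _; apply: h2.
- by move=> z tz; case: eqP => // _; apply: h3.
- by move=> z e tz eG ze; apply: hit_include; apply: h4 ze.
Qed.

(** * The subroutines and the processing of one step *)

Lemma final_include_step y s :
  final (include_step c D y) s =
  if included (stat s (row y)) then s else include_mem y s.
Proof.
rewrite /include_step final_bind /=; rewrite /final /result /=.
by case: (included _).
Qed.

Lemma pure_covered_by_other t i e :
  pure_prog (covered_by_other D t i e) (fun s => has (fun j =>
    [&& j != i, table s (row (t + j)) e & ~~ excluded (stat s (row (t + j)))])
    (iota 0 D)).
Proof.
move=> s; have H : pure_prog (covered_by_other D t i e) (fun s =>
    foldl (fun found j => found || [&& j != i, table s (row (t + j)) e
     & ~~ excluded (stat s (row (t + j)))]) false (iota 0 D)) by apply: pure_fold.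
by have [-> ->] := H s; rewrite foldl_has.
Qed.

Lemma pure_has_uncovered_edge t i :
  pure_prog (has_uncovered_edge G D t i) (fun s => has (fun e =>
    table s (row (t + i)) e && ~~ has (fun j =>
    [&& j != i, table s (row (t + j)) e & ~~ excluded (stat s (row (t + j)))])
    (iota 0 D)) (enum (edges G))).
Proof.
move=> s; pose uncovered s e := table s (row (t + i)) e && ~~ has (fun j =>
    [&& j != i, table s (row (t + j)) e & ~~ excluded (stat s (row (t + j)))])
    (iota 0 D).
have H : pure_prog (has_uncovered_edge G D t i) (fun s =>
    foldl (fun found e => found || uncovered s e) false (enum (edges G))).
  apply: pure_fold => found e s'; rewrite final_bind result_bind /uncovered /=.
  rewrite final_read_cell result_read_cell.
  case: (table s' _ e); last by rewrite orbF.
  rewrite final_bind result_bind.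
  by have [-> ->] := pure_covered_by_other t i e s'.
by have [-> ->] := H s; rewrite foldl_has.
Qed.

(** Specifies one accumulator of [best_other] after [n] iterations: [o] holds an absolute step,
    while [P] tests indices relative to [t]. *)
Definition is_last_index (t n : nat) (P : pred nat) (o : option nat) :=
  if o is Some y then
    exists j, [/\ y = t + j, j < n, P j & forall k, k < n -> P k -> k <= j]
  else forall k, k < n -> ~~ P k.

Lemma is_last_index_step t n P o :
  is_last_index t n P o -> is_last_index t n.+1 P (if P n then Some (t + n) else o).
Proof.
case: (boolP (P n)) => Pn /=.
  by move=> _; exists n; split=> // k; rewrite ltnS.
case: o => [y [j [-> jn Pj h]]|h] /=; last first.
  by move=> k; rewrite ltnS leq_eqVlt => /orP[/eqP->|/h].
exists j; split=> //; first exact: ltnW.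
by move=> k; rewrite ltnS leq_eqVlt => /orP[/eqP->|/h //]; rewrite (negPf Pn).
Qed.

Lemma best_other_spec t i e s :
  let P x j := [&& j != i, table s (row (t + j)) e & x (stat s (row (t + j)))] in
  let available x := ~~ included x && ~~ excluded x in
  final (best_other D t i e) s = s /\
  exists o1 o2, [/\ is_last_index t D (P included) o1,
    is_last_index t D (P available) o2
    & result (best_other D t i e) s = if o1 is Some y then Some y else o2].
Proof.
move=> P available; rewrite /best_other final_bind result_bind.
pose f s (acc : option nat * option nat) j :=
  if (j != i) && table s (row (t + j)) e then
    match stat s (row (t + j)) with
    | Included => (Some (t + j), acc.2)
    | Available => (acc.1, Some (t + j))
    | Excluded => acc
    end else acc.
set p := fold_loop _ _ _.
have H : pure_prog p (fun s => foldl (f s) (None, None) (iota 0 D)) by apply: pure_fold.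
have [-> ->] := H s; split=> //; set acc := foldl _ _ _; exists acc.1, acc.2.
suff [] : is_last_index t D (P included) acc.1 /\ is_last_index t D (P available) acc.2.
  by split=> //; case: acc => -[].
(* The induction is on the loop bound only: the [D] hidden in the bodies of [P] and [f], which is
   the modulus of the ring buffer, stays fixed. *)
rewrite /acc; elim: D => [|n [IH1 IH2]] //.
rewrite -addn1 iotaD foldl_cat /= add0n addn1.
move: IH1 IH2; set acc' := foldl _ _ _.
move=> /is_last_index_step IH1 /is_last_index_step IH2; move: IH1 IH2.
rewrite /f /P /available; case: (n != i) => //=; case: (table _ _ _) => //=.
by case: (stat _ _).
Qed.

(** The bound [t + (0 < i)] says that window [t] is no witness yet when its first step comes up, so
    that this step may itself be included; afterwards only steps later than [t] are added. *)
Lemma process_step_inv t i s :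
    i < D -> 1 <= t ->
    window_inv t (t + (0 < i)) (t + i) (t + i) s ->
  window_inv t t.+1 (t + i.+1) (t + i.+1) (final (process_step G c D t i) s).
Proof.
move=> iD t0 I; set y := t + i.
have ty : in_window D t y by rewrite /in_window /y; lia.
have tj j : j < D -> t <= t + j < t + D by lia.
have le_b : t + (0 < i) <= t.+1 by case: (0 < i); lia.
have [C exc ava don] := I; have tab := core_table C; have sta := core_stat C.
(* Shared end of the two branches in which [y] is included, either earlier or now. *)
have advance s' : window_inv t t.+1 y y s' -> stat s' (row y) <> Available ->
    (forall e, e \in edges G -> y \in lambda e -> hit (cover s') t e) ->
    window_inv t t.+1 (t + i.+1) (t + i.+1) s'.
  case=> h1 h2 h3 h4 nav hy; rewrite addnS; split=> //.
  - by move=> z tz /(h2 _ tz); lia.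
  - move=> z tz ez; have := h3 _ tz ez; rewrite leq_eqVlt => /orP[/eqP E|] //.
    by rewrite -E in ez.
  - move=> z e tz eG; case: (eqVneq z y) => [->|ne]; first exact: hy.
    by apply: h4 => //; move: ne tz; rewrite /y; lia.
rewrite /process_step final_bind final_read_status result_read_status -/y.
case: ifPn => [inc|Ninc].
  apply: advance; first by case: I => *; split=> //; apply: core_widen C.
    by move=> E; rewrite E in inc.
  by move=> e eG ye; exists y; split=> //; rewrite -sta.
rewrite final_bind; have [-> ->] := pure_has_uncovered_edge t i s.
case: ifPn => [/hasP[e]|needed].
  rewrite mem_enum => eG /andP[]; rewrite tab // => ye /hasPn Nother.
  (* Another step [z] covering [e] would be excluded, hence already processed, so [e] would be
     served by an included [w]. As [y] is not included, [w] differs from [y] and would be excluded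
     too, a contradiction. *)
  have private z : in_window D t z -> z \in lambda e -> z = y.
    have Nj j : j < D -> j != i -> t + j \in lambda e -> stat s (row (t + j)) = Excluded.
      move=> jD ji je; have := Nother j; rewrite mem_iota add0n => /(_ jD).
      by rewrite ji tab ?tj // je /=; case: (stat s _).
    move=> tz ze; apply/eqP/negPn/negP => zNy.
    have [zE zj] : z = t + (z - t) /\ z - t < D by move: tz; rewrite /in_window; lia.
    have zi : z - t != i by move: zNy tz; rewrite /y /in_window; lia.
    have exz : stat s (row z) = Excluded by rewrite zE Nj // -zE.
    have [|w [tw we wX]] := don z e _ eG ze.
      by move: tz (exc _ tz exz); rewrite /in_window; lia.
    have wNy : w != y.
      by apply: contra Ninc => /eqP <-; rewrite sta.
    have [wE wj] : w = t + (w - t) /\ w - t < D by move: tw; rewrite /in_window; lia.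
    have wi : w - t != i by move: wNy tw; rewrite /y /in_window; lia.
    have := Nj _ wj wi; rewrite -wE => /(_ we) E.
    by move: wX; rewrite -sta // E.
  rewrite final_include_step (negPf Ninc); apply: advance.
  - apply: window_inv_include I => //; first by rewrite /y; case: (i); lia.
    exists e; split=> // [z tz ze|te]; first by rewrite (private z).
    by rewrite (private t) ?eqxx //; rewrite /in_window; lia.
  - by rewrite /= eqxx.
  - by move=> e' eG' ye'; exists y; split=> //=; rewrite in_fset1U eqxx.
rewrite final_bind; set s1 := final (write_status _ _) s; set l := enum _.
(* The third clause, obtained from the failed search for an uncovered edge, guarantees that
   [best_other] finds a replacement; it survives because the loop excludes no further step. *)
pose J (l1 : seq {set V}) s' := [/\ window_inv t t.+1 y y.+1 s', stat s' (row y) = Excluded,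
  forall e, e \in edges G -> y \in lambda e -> exists j,
    [/\ j < D, j != i, t + j \in lambda e & stat s' (row (t + j)) <> Excluded]
  & forall e, e \in l1 -> y \in lambda e -> hit (cover s') t e].
have Jl : J l (final (loop l (fun e : {set V} =>
    exec b <- read_cell (row (t + i)) e;
    if b then exec o <- best_other D t i e;
              if o is Some z then include_step c D z else ret tt
    else ret tt)) s1).
  apply: loop_inv => [l1 e l2 s' El [I' ex1 noex hl1]|]; last first.
    rewrite /s1 /final /=; split=> //=; [|by rewrite eqxx|].
    - split=> /=.
      + apply: core_widen le_b _; apply: core_restat C => //= z tz.
        by case: eqP => // /(row_inj tz ty) ->; rewrite (negPf Ninc).
      + move=> z tz; case: eqP => [/(row_inj tz ty) -> //|_] /(exc _ tz).
        by rewrite /y; lia.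
      + move=> z tz; case: eqP => // ne /(ava _ tz).
        by rewrite leq_eqVlt => /orP[/eqP E|//]; rewrite -E in ne.
      + exact: don.
    - move=> e eG ye; move/hasPn: needed => /(_ e).
      rewrite mem_enum tab // ye /= negbK => /(_ eG) /hasP[j].
      rewrite mem_iota add0n => /andP[_ jD] /and3P[ji].
      rewrite tab ?tj // => je Nex; exists j; split=> //.
      case: eqP => [/(row_inj (tj _ jD) ty) E|_ E]; last by rewrite E in Nex.
      by move: ji; rewrite -(eqn_add2l t) E eqxx.
  have eG : e \in edges G by rewrite -mem_enum -/l El mem_cat inE eqxx orbT.
  have [C' exc' ava' don'] := I'; have tab' := core_table C'; have sta' := core_stat C'.
  have Jskip : (y \in lambda e -> hit (cover s') t e) -> J (rcons l1 e) s'.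
    move=> he; split=> // e'; rewrite mem_rcons inE => /orP[/eqP-> //|]; exact: hl1.
  rewrite final_bind final_read_cell result_read_cell -/y tab' //.
  case: ifPn => [ye|Nye]; last by apply: Jskip => ye; rewrite ye in Nye.
  rewrite final_bind.
  have [-> [o1 [o2 [L1 L2 ->]]]] := best_other_spec t i e s'.
  case: o1 L1 => [? [j [-> jD /and3P[ji je jinc] _]]|NL1].
    rewrite final_include_step jinc; apply: Jskip => _; exists (t + j).
    by split; [apply: tj | rewrite -tab' // tj | rewrite -sta' // tj].
  case: o2 L2 => [? [j [-> jD /and3P[ji je /andP[jNinc jNex]] jmax]]|NL2]; last first.
    have [j [jD ji je]] := noex e eG ye.
    move: (NL1 j jD) (NL2 j jD); rewrite ji tab' ?tj // je /=.
    by case: (stat s' _).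
  rewrite final_include_step (negPf jNinc).
  (* By [wi_avail], available steps are at least [n = y + 1]. *)
  have lt_yj : y < t + j.
    by apply: (ava' _ (tj _ jD)); case: (stat s' _) jNinc jNex.
  have wj : witnessed (cover s') t (t + j).
    exists e; split=> //; [exact: tj | by rewrite -tab' ?tj // | | ].
      (* A competitor [z] other than [y] cannot be included by [NL1], is bounded by [jmax] if
         available, and does not exceed [y] if excluded. *)
      move=> z tz ze.
      have [zE zj] : z = t + (z - t) /\ z - t < D by move: tz; rewrite /in_window; lia.
      case: (eqVneq (z - t) i) => [zi|zi]; first by move: lt_yj; rewrite /y; lia.
      case Ez: (stat s' (row z)).
      - by move: (NL1 _ zj); rewrite -zE zi tab' // ze Ez.
      - rewrite {1}zE leq_add2l; apply: jmax => //.
        by rewrite -zE zi tab' // ze Ez.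
      - by move: (exc' _ tz Ez); lia.
    have tt0 : in_window D t t by rewrite /in_window; lia.
    (* The first step of the window is not included: for [i = 0] it is [y] itself, just excluded;
       otherwise it is another step covering [e], and [NL1] applies. *)
    rewrite -sta' // => te _; case: (eqVneq i 0) => [i0|i0].
      by move: ex1; rewrite /y i0 addn0 => ->.
    have D0 : 0 < D by lia.
    by move: (NL1 0 D0); rewrite addn0 eq_sym i0 tab' // te.
  have I'' := @window_inv_include t t.+1 y y.+1 (t + j) s' t0 (leqnn _)
     (leq_ltn_trans (leq_addr _ _) lt_yj) wj I'.
  split=> //=.
  - by case: eqP => // /(row_inj ty (tj _ jD)) E; move: lt_yj; rewrite -E ltnn.
  - move=> e' eG' ye'; have [k [kD ki ke kN]] := noex e' eG' ye'.
    by exists k; split=> //; case: eqP.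
  - move=> e'; rewrite mem_rcons inE => /orP[/eqP-> _|e'l /(hl1 _ e'l)]; last exact: hit_include.
    by exists (t + j); split; [exact: tj | rewrite -tab' ?tj | rewrite in_fset1U eqxx].
case: Jl => [[h1 h2 h3 h4] _ _ hl]; rewrite addnS; split=> // z e tz eG.
case: (eqVneq z y) => [->|ne]; first by apply: hl; rewrite mem_enum.
by apply: h4 => //; move: ne tz; rewrite /y; lia.
Qed.

(** * Loading, sliding and the whole run *)

Lemma load_step_inv lo b y s :
    lo <= y < lo + D -> core lo y b s ->
  core lo y.+1 b (final (load_step G D y) s).
Proof.
move=> hy [h1 h2 h3 h4 h5]; rewrite /load_step final_bind.
set p := loop _ _; pose J (l1 : seq {set V}) s' := [/\ stat s' = stat s,
  cover s' = cover s & forall r e, table s' r e =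
    if (r == row y) && (e \in l1) then y \in lambda e else table s r e].
have [et ec tabE] : J (enum (edges G)) (final p s).
  apply: loop_inv => [l1 e l2 s' _ [es ec tabE]|]; last first.
    by split=> // r e; rewrite andbF.
  split=> // r e' /=; rewrite tabE mem_rcons inE.
  by case: (r == row y); case: eqP => // ->.
move: (final p s) et ec tabE => s1 et ec tabE.
(* Since [y < lo + D], the overwritten row belongs to no other step in the range. *)
have row_neq z : lo <= z < y.+1 -> z != y -> row z != row y.
  move=> hz; apply: contra => /eqP E; apply/eqP.
  by apply: (row_inj (t := lo)) E; rewrite /in_window; lia.
split=> /=; rewrite ?ec //.
- move=> z e hz eG; rewrite tabE mem_enum eG andbT.
  have [->|ne] := eqVneq z y; first by rewrite eqxx.
  by rewrite (negPf (row_neq _ hz ne)) h1 //; lia.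
- move=> z hz; have [->|ne] := eqVneq z y.
    (* By [core_cover] the output only has steps before [y], so the fresh status [Available] agrees
       with it. *)
    by rewrite eqxx; apply/esym/negP => /h3 [_] /=; lia.
  by rewrite (negPf (row_neq _ hz ne)) et h2 //; lia.
- by move=> a /h3 [-> /andP[-> /= /ltnW]].
Qed.

(** With [n = t], [wi_excl] forbids excluded steps in the whole window, which is what the resetting
    loop achieves. *)
Lemma slide_window_inv t s :
    0 < D -> core t (t + D - 1) t s ->
  window_inv t t t t (final (slide_window G D t) s).
Proof.
move=> D0 C; rewrite /slide_window final_bind.
have {C} : core t (t + D) t (final (load_step G D (t + D - 1)) s).
  have E : (t + D - 1).+1 = t + D by lia.
  by rewrite -{1}E; apply: load_step_inv => //; lia.
move: (final (load_step _ _ _) s) => s1 C.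
have tj j : j < D -> t <= t + j < t + D by lia.
pose J k s' := core t (t + D) t s' /\
  forall j, j < k -> j < D -> stat s' (row (t + j)) <> Excluded.
set p := loop _ _; have [C1 Nex] : J (0 + D) (final p s1).
  apply: loop_iota_inv => // i s' /andP[_ iD] [C' Nex'].
  rewrite final_bind final_read_status result_read_status.
  case Es: (stat s' (row (t + i))) => /=.
  - split=> // j; rewrite ltnS leq_eqVlt => /orP[/eqP->|/Nex' //]; by rewrite Es.
  - split=> // j; rewrite ltnS leq_eqVlt => /orP[/eqP->|/Nex' //]; by rewrite Es.
  - split=> [|j]; rewrite /final /=.
      by apply: core_restat C' => //= z tz; case: eqP => // ->; rewrite Es.
    rewrite ltnS leq_eqVlt => /orP[/eqP->|ji jD]; first by rewrite eqxx.
    by case: eqP => // _; apply: Nex'.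
split=> // [y ty E|y ty _|y e]; [|by move: ty; rewrite /in_window; lia | lia].
case: (Nex (y - t)); [| | rewrite -E; congr (stat _ (row _))];
  move: ty; rewrite /in_window; lia.
Qed.

(** Once all [D] steps are processed, window [t] joins the finished ones: each of its edges is
    active at some step of the window, to which [wi_done] applies. *)
Lemma window_inv_core t s :
    0 < D -> window_inv t t.+1 (t + D) (t + D) s ->
  core t.+1 (t.+1 + D - 1) t.+1 s.
Proof.
move=> D0 [[h1 h2 h3 h4 h5] _ _ don]; rewrite addSn subn1 /=.
split=> //; try by move=> y *; (apply: h1 || apply: h2) => //; lia.
move=> t' e /andP[t'0]; rewrite ltnS leq_eqVlt => /orP[/eqP->|lt_t't].
  rewrite inE => /andP[eG /hasP[y ye ty]]; exact: don ty eG ye.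
by apply: h5; rewrite t'0.
Qed.

Lemma star_acov_inv :
    0 < D <= lifetime G ->
  core (lifetime G - D + 1).+1 (lifetime G).+1 (lifetime G - D + 1).+1
    (final (star_acov G c D) (memory0 V)).
Proof.
move=> /andP[D0 DT]; rewrite /star_acov final_bind.
(* Preloading stops one step short of a full window, since each slide loads the last step of its
   window. *)
have C0 : core 1 (1 + (D - 1)) 1 (final (loop (iota 1 (D - 1)) (load_step G D)) (memory0 V)).
  apply: (loop_iota_inv (J := fun k => core 1 k 1)) => [i s hi|].
    by apply: load_step_inv; lia.
  by split=> //= y; lia.
rewrite -(add1n (lifetime G - D + 1)).
have -> : (lifetime G).+1 = 1 + (lifetime G - D + 1) + D - 1 by lia.
apply: (loop_iota_inv (J := fun t => core t (t + D - 1) t)); last first.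
  by rewrite -addnBA.
move=> t s ht C; apply: window_inv_core => //; rewrite final_bind.
have {C} I := slide_window_inv D0 C; move: (final (slide_window _ _ _) s) I => s1 I.
pose J i := window_inv t (t + (0 < i)) (t + i) (t + i).
have : J (0 + D) (final (loop (iota 0 D) (process_step G c D t)) s1).
  apply: loop_iota_inv => [i s' iD I'|]; last by rewrite /J !addn0.
  by rewrite /J addn1; apply: process_step_inv => //; lia.
by rewrite /J D0 addn1.
Qed.

End StarAcovAnalysis.

(** * Feasibility of the output and the charging argument *)

Section Approximation.
Variables (V : finType) (G : tgraph V) (c : nat -> V) (D : nat).
Hypotheses (star : always_star G c) (D_gt1 : 1 < D) (D_le : D <= lifetime G).
Local Notation X := (star_acov_output G c D).

Lemma star_acov_output_inv : exists s,
  cover s = X /\ core G c D (lifetime G - D + 1).+1 (lifetime G).+1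
    (lifetime G - D + 1).+1 s.
Proof.
exists (final (star_acov G c D) (memory0 V)); split=> //.
by apply: star_acov_inv; rewrite D_le ltnW.
Qed.

Lemma star_acov_tvc : is_tvc G D X.
Proof.
have [s [<- [_ _ cov _ past]]] := star_acov_output_inv.
split=> [a /cov [_]|t ht e he]; first by rewrite ltnS.
have eG : e \in edges G by move: he; rewrite inE => /andP[].
have [z [tz ze zX]] := past t e ht he; exists (c z, z); split=> //.
rewrite /temporally_covers ze andbT; apply: (star (labels_lifetime eG ze)).
by rewrite inE eG.
Qed.

(** Of the [D] steps from [t] on, the last is dropped if step [t] is output, and the first
    otherwise. *)
Definition charged t : seq nat :=
  iota (if (c t, t) \in X then t else t.+1) (D - 1).

Lemma star_acov_charged S y :
  is_tvc G D S -> (c y, y) \in X -> exists2 a, a \in S & y \in charged a.2.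
Proof.
move=> [_ hS] yX; have [s [Es [_ _ _ wit _]]] := star_acov_output_inv.
rewrite Es in wit; have [t ht [e [eG ty ye lst tX]]] := wit _ yX.
have [a [x [aS ax xt xe]]] : exists a (x : nat),
    [/\ a \in S, a.2 = x, in_window D t x & x \in labels G e].
  have [||a [aS xt /andP[_ xe]]] := hS t _ e; first by rewrite -ltnS.
    by rewrite inE eG; apply/hasP; exists y.
  by exists a, a.2.
exists a => //; rewrite ax mem_iota; have le_xy := lst _ xt xe.
rewrite /in_window /= in le_xy xt ty tX; case: ifPn => [xX|xNX].
  (* The goal needs [y < x + D - 1]. For [x > t] it follows from [y < t + D], for [x = t = y] from
     [D > 1]; the case [x = t < y] contradicts the witness, by which [t] is not output. *)
  case: (eqVneq x t) => [Ex|ne]; last by lia.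
  case: (eqVneq t y) => [|ne']; first by lia.
  by rewrite Ex in xX xe; have := tX xe ne'; rewrite xX.
have : x != y by apply: contra xNX => /eqP ->.
lia.
Qed.

(** Projecting the output to its steps is injective, as the vertex is always the center of the step;
    these distinct steps all occur in the concatenation of the charged intervals. *)
Lemma star_acov_approx S : is_tvc G D S -> #|` X| <= (D - 1) * #|` S|.
Proof.
move=> hS; have [s [Es [_ _ cov _ _]]] := star_acov_output_inv; rewrite Es in cov.
have -> : (D - 1) * #|` S| = size (flatten [seq charged a.2 | a <- enum_fset S]).
  elim: (enum_fset S) => [|a l IH] /=; first by rewrite muln0.
  by rewrite mulnS size_cat size_iota IH.
have -> : #|` X| = size [seq a.2 | a <- enum_fset X] by rewrite size_map.
apply: uniq_leq_size.
  rewrite map_inj_in_uniq ?fset_uniq // => -[u y] [v z] /cov [/= -> _] /cov [/= -> _].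
  by move->.
move=> y /mapP[[u z] zX /= ->]; have /= [Eu _] := cov _ zX; rewrite Eu in zX.
have [a aS za] := star_acov_charged hS zX.
by apply/flattenP; exists (charged a.2) => //; apply/mapP; exists a.
Qed.

End Approximation.

Theorem theorem2 :
  exists C : nat,
  forall (V : finType) (G : tgraph V) (c : nat -> V) (Delta : nat),
    always_star G c -> 2 <= Delta -> Delta <= lifetime G ->
    [/\ is_tvc G Delta (star_acov_output G c Delta),
        forall S : {fset V * nat}, is_minimum_tvc G Delta S ->
          #|` star_acov_output G c Delta| <= (Delta - 1) * #|` S|
      & 0 < #|edges G| ->
          star_acov_time G c Delta
            <= C * (lifetime G * #|edges G| * Delta ^ 2)].
Proof.
exists 50 => V G c D star D_gt1 D_le; split.
- exact: star_acov_tvc.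
- by move=> S [hS _]; exact: star_acov_approx.
- by move=> m_gt0; apply: star_acov_timeP => //; exact: ltnW.
Qed.
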